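(* Let $\mathcal{A}$ be a complex Banach algebra with unity, $k$ a positive integer, and let $a,b\in\mathcal{A}$ both be g$\pi$-Hirano invertible. Suppose $\alpha_{1}\cdots\alpha_{k}ab=\alpha_{1}\cdots\alpha_{k}ba$ for all $\alpha_{1},\dots,\alpha_{k}\in\{a,b\}$. Then $1+a^{g\pi H}b$ is g$\pi$-Hirano invertible if and only if $a+b$ is g$\pi$-Hirano invertible.
   Context: $\mathcal{A}^{qnil}$ denotes the set of quasinilpotent elements of $\mathcal{A}$ (spectrum equal to $\{0\}$). An element $x\in\mathcal{A}$ is a g$\pi$-Hirano inverse of $a$ if $xax=x$, $ax=xa$ and $a-a^{n+2}x\in\mathcal{A}^{qnil}$ for some positive integer $n$; it is unique when it exists and is denoted $a^{g\pi H}$, and $a$ is then called g$\pi$-Hirano invertible. *)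

(* Defs.v *)
From HB Require Import structures.
From mathcomp Require Import all_boot all_order all_algebra.
From mathcomp Require Import complex.
From mathcomp Require Import all_classical all_reals.
Set Implicit Arguments. Unset Strict Implicit. Unset Printing Implicit Defensive.
Import Order.TTheory GRing.Theory Num.Theory.
Local Open Scope ring_scope.
Local Open Scope classical_set_scope.

Definition cnorm (R : realType) (c : R[i]) : R := ComplexField.Normc.normc c.

Record banach_algebra_norm (R : realType) (A : algType R[i]) (nrm : A -> R)
  : Prop := BanachAlgebraNorm {
  bnorm_ge0 : forall x, 0 <= nrm x ;
  bnorm_eq0 : forall x, nrm x = 0 -> x = 0 ;
  bnorm_triangle : forall x y, nrm (x + y) <= nrm x + nrm y ;
  bnorm_scale : forall (c : R[i]) x, nrm (c *: x) = cnorm c * nrm x ;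
  bnorm_submul : forall x y, nrm (x * y) <= nrm x * nrm y ;
  bnorm_one : nrm 1 = 1 ;
  bnorm_complete : forall u : nat -> A,
    (forall e : R, 0 < e -> exists N : nat, forall m n : nat,
        (N <= m)%N -> (N <= n)%N -> nrm (u m - u n) < e) ->
    exists l : A, forall e : R, 0 < e -> exists N : nat, forall n : nat,
        (N <= n)%N -> nrm (u n - l) < e
}.

Section Defs.
Variables (R : realType) (A : algType R[i]).

Definition invertible (x : A) : Prop := exists y : A, x * y = 1 /\ y * x = 1.

Definition spectrum (x : A) : set R[i] := [set l : R[i] | ~ invertible (l%:A - x)].

Definition quasinilpotent (x : A) : Prop := spectrum x = [set 0].

Definition gpiH_inverse (a x : A) : Prop :=
  [/\ x * a * x = x, a * x = x * a &
      exists n : nat, (0 < n)%N /\ quasinilpotent (a - a ^+ (n + 2) * x)].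

Definition gpiH_invertible (a : A) : Prop := exists x : A, gpiH_inverse a x.
End Defs.

(* Main.v *)
Require Import Defs.
From HB Require Import structures.
From mathcomp Require Import all_boot all_order all_algebra.
From mathcomp Require Import complex.
From mathcomp Require Import all_classical all_reals.
From mathcomp Require Import topology normedtype.
From mathcomp Require Import ring lra.
Set Implicit Arguments.
Unset Strict Implicit.
Import Order.TTheory GRing.Theory Num.Theory.
Import numFieldNormedType.Exports.
Local Open Scope ring_scope.

(* Up to multiplication by words of length [k], the elements [a] and [b] commute.
   An element [x] is g-pi-Hirano invertible iff [x - x^(N+1)] is quasinilpotent for
   some [N > 0]; the nontrivial direction lifts the almost idempotent [x^N] to an
   idempotent. In this form the property passes to products with an element [u]
   such that [u^m] is a unit up to a quasinilpotent, as soon as everything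
   commutes, which settles the corner cut out by the idempotent [p = a a^{gpiH}].
   On the complementary corner [a] is quasinilpotent, and adding it to [b] does not
   enlarge the nonzero spectrum because the commutator is killed by long words.
   The two corners are glued by triangularity.

   The only analytic input is that an element without nonzero spectrum satisfies
   [|x^n| <= C e^n] for every [e > 0]. Following Rickart, this is obtained from the
   uniform continuity of the resolvent and an averaging over roots of unity, so
   that no complex analysis is involved. *)

(** * Tactics for identities and commutation in a noncommutative ring *)

Section ZmoduleNormalisation.

Lemma addr_cancel (V : zmodType) (x s s' : V) : s = - x + s' -> s' = 0 -> x + s = 0.
Proof. by move=> -> ->; rewrite addr0 subrr. Qed.

Lemma addr_cancelN (V : zmodType) (x s s' : V) : s = x + s' -> s' = 0 -> - x + s = 0.
Proof. by move=> -> ->; rewrite addr0 addNr. Qed.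

Lemma addr_skip (V : zmodType) (t y s s' : V) : s = y + s' -> t + s = y + (t + s').
Proof. by move=> ->; rewrite addrCA. Qed.

End ZmoduleNormalisation.

(** The remainder stays an existential variable, instantiated once the summand [y] is located in a
    right-nested sum. *)
Ltac find_term := lazymatch goal with
  | |- ?t + ?s = ?y + _ => first [unify t y; reflexivity | apply: addr_skip; find_term]
  | |- ?t = ?y + _ => symmetry; apply: addr0
  end.

Ltac cancel_terms := lazymatch goal with
  | |- 0 = 0 => reflexivity
  | |- - _ + _ = 0 => apply: addr_cancelN; [find_term | cancel_terms]
  | |- _ + _ = 0 => apply: addr_cancel; [find_term | cancel_terms]
  end.

Ltac ncring := apply: subr0_eq;
  rewrite ?(mulrDl, mulrDr, mulrN, mulNr, opprD, opprK, mulr1, mul1r, mulr0, mul0r, oppr0, mulrA);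
  rewrite -?addrA ?(addr0, add0r); cancel_terms.

Lemma comm_scale (K : pzRingType) (A : algType K) (x y : A) (l : K) :
  GRing.comm x y -> GRing.comm x (l *: y).
Proof. by move=> c; rewrite /GRing.comm -scalerAl -scalerAr c. Qed.

Ltac comm_solve := match goal with
  | H : GRing.comm ?x ?y |- GRing.comm ?x ?y => exact: H
  | H : GRing.comm ?y ?x |- GRing.comm ?x ?y => exact: (commr_sym H)
  | |- GRing.comm ?x ?x => exact: commr_refl
  | |- GRing.comm _ 1 => exact: commr1
  | |- GRing.comm _ (_ + _) => apply: commrD; comm_solve
  | |- GRing.comm _ (- _) => apply: commrN; comm_solve
  | |- GRing.comm _ (_ * _) => apply: commrM; comm_solve
  | |- GRing.comm _ (_ ^+ _) => apply: commrX; comm_solve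
  | |- GRing.comm _ (_ *: _) => apply: comm_scale; comm_solve
  | |- GRing.comm 1 _ => apply: commr_sym; exact: commr1
  | |- GRing.comm (_ + _) _ => apply: commr_sym; comm_solve
  | |- GRing.comm (- _) _ => apply: commr_sym; comm_solve
  | |- GRing.comm (_ * _) _ => apply: commr_sym; comm_solve
  | |- GRing.comm (_ ^+ _) _ => apply: commr_sym; comm_solve
  | |- GRing.comm (_ *: _) _ => apply: commr_sym; comm_solve
  end.

(** * Norm estimates, Neumann series and elements of vanishing spectral radius *)

Section BanachAlgebra.
Variables (R : realType) (A : algType R[i]) (nrm : A -> R).
Hypothesis HA : banach_algebra_norm nrm.
Implicit Types (x y z : A) (l : R[i]) (e C : R).

Let ge0 := bnorm_ge0 HA.
Let nD := bnorm_triangle HA.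
Let nM := bnorm_submul HA.
Let n1 := bnorm_one HA.
Let nZ := bnorm_scale HA.

Lemma cnormM l (m : R[i]) : cnorm (l * m) = cnorm l * cnorm m.
Proof. exact: ComplexField.Normc.normcM. Qed.

Lemma cnorm_ge0 l : 0 <= cnorm l.
Proof. by case: l => a b; rewrite /cnorm /= sqrtr_ge0. Qed.

Lemma cnormN1 : cnorm (-1 : R[i]) = 1.
Proof. by rewrite /cnorm /= oppr0 sqrrN expr1n expr0n addr0 sqrtr1. Qed.

Lemma cnorm1 : cnorm (1 : R[i]) = 1.
Proof. exact: ComplexField.Normc.normc1. Qed.

Lemma cnormX l n : cnorm (l ^+ n) = cnorm l ^+ n.
Proof. by elim: n => [|n IH]; rewrite ?expr0 ?cnorm1 // !exprS cnormM IH. Qed.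

Lemma cnormV l : cnorm l^-1 = (cnorm l)^-1.
Proof. exact: ComplexField.Normc.normcV. Qed.

Lemma cnorm_real (r : R) : cnorm (r%:C)%C = `|r|.
Proof. by rewrite /cnorm /= expr0n addr0 sqrtr_sqr. Qed.

Lemma cnorm_half : cnorm (2^-1 : R[i]) = 2^-1.
Proof.
rewrite cnormV; congr (_^-1).
have -> : (2 : R[i]) = ((2 : R)%:C)%C by rewrite rmorph_nat.
by rewrite cnorm_real ger0_norm.
Qed.

Lemma nrmN x : nrm (- x) = nrm x.
Proof. by rewrite -scaleN1r nZ cnormN1 mul1r. Qed.

Lemma nrm0 : nrm 0 = 0.
Proof.
have := nZ 0 0; rewrite scale0r => ->.
by rewrite /cnorm ComplexField.Normc.normc0 mul0r.
Qed.

Lemma nrmB x y : nrm (x - y) <= nrm x + nrm y.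
Proof. by have := nD x (- y); rewrite nrmN. Qed.

Lemma nrm_distC x y : nrm (x - y) = nrm (y - x).
Proof. by rewrite -nrmN opprB. Qed.

Lemma nrm_dist_triangle y x z : nrm (x - z) <= nrm (x - y) + nrm (y - z).
Proof. by have := nD (x - y) (y - z); rewrite addrA subrK. Qed.

Lemma nrmX x n : nrm (x ^+ n) <= nrm x ^+ n.
Proof.
elim: n => [|n IH]; first by rewrite !expr0 n1.
by rewrite !exprS; apply: le_trans (nM _ _) _; exact: ler_wpM2l.
Qed.

Lemma nrm_sum (I : Type) (s : seq I) (P : pred I) (F : I -> A) :
  nrm (\sum_(i <- s | P i) F i) <= \sum_(i <- s | P i) nrm (F i).
Proof.
elim/big_rec2: _ => [|i u v _ le_vu]; first by rewrite nrm0.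
by apply: le_trans (nD _ _) _; rewrite lerD2l.
Qed.

Lemma nrmMn x n : nrm (x *+ n) <= nrm x *+ n.
Proof.
elim: n => [|n IH]; first by rewrite !mulr0n nrm0.
by rewrite !mulrS; apply: le_trans (nD _ _) _; rewrite lerD2l.
Qed.

Lemma half_pow_lt C e : 0 < e -> exists N, forall n, (N <= n)%N -> C / 2 ^+ n < e.
Proof.
move=> e0; have [N hN] : exists N, C / e < N%:R.
  have [C0|C0] := leP 0 (C / e); last by exists 0.
  by exists (Num.bound (C / e)); exact: archi_boundP.
exists N => n le_Nn; rewrite ltr_pdivrMr ?exprn_gt0 // mulrC -ltr_pdivrMr //.
apply: lt_le_trans hN _; rewrite -natrX ler_nat.
by apply: leq_trans le_Nn _; apply: ltnW; exact: ltn_expl.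
Qed.

Lemma le_half_pow_eq0 x C : (forall n, nrm x <= C / 2 ^+ n) -> x = 0.
Proof.
move=> h; apply: (bnorm_eq0 HA); apply/eqP; rewrite eq_le ge0 andbT leNgt.
apply/negP => x0; have [N hN] := half_pow_lt C x0.
by have := lt_le_trans (hN N (leqnn _)) (h N); rewrite ltxx.
Qed.

(** Completeness of the algebra enters through this form only; the explicit rate lets identities for
    the limit be checked by [le_half_pow_eq0]. *)
Lemma geometric_limit (u : nat -> A) C :
  (forall n, nrm (u n.+1 - u n) <= C / 2 ^+ n) ->
  exists v : A, forall n, nrm (u n - v) <= 2 * C / 2 ^+ n.
Proof.
move=> h.
have C0 : 0 <= C by have := h 0; rewrite expr0 divr1; exact: le_trans (ge0 _).
(* Subtracting the tail [2 * C / 2 ^+ (n + d)] closes the induction on [d] without summing a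
   geometric series. *)
have cau n d : nrm (u (n + d)%N - u n) <= 2 * C / 2 ^+ n - 2 * C / 2 ^+ (n + d).
  elim: d => [|d IH]; first by rewrite addn0 !subrr nrm0.
  have e : 2 * C / 2 ^+ (n + d.+1) = C / 2 ^+ (n + d).
    by rewrite addnS exprS -mulf_div divff ?mul1r ?pnatr_eq0.
  rewrite e addnS; apply: le_trans (nrm_dist_triangle (u (n + d)%N) _ _) _.
  by apply: le_trans (lerD (h _) IH) _; rewrite -[2 * C / 2 ^+ (n + d)]mulrA; lra.
have {}cau m n : (n <= m)%N -> nrm (u m - u n) <= 2 * C / 2 ^+ n.
  move=> /subnKC <-; apply: le_trans (cau _ _) _.
  by rewrite gerBl divr_ge0 ?mulr_ge0 ?exprn_ge0.
have [v hv] : exists v : A, forall e, 0 < e -> exists N, forall n, (N <= n)%N -> nrm (u n - v) < e.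
  apply: (bnorm_complete HA) => e e0.
  have [N hN] := half_pow_lt (2 * C) e0.
  exists N => m n; wlog le_nm : m n / (n <= m)%N.
    move=> W hm hn; have /orP[|] := leq_total n m; first by move/W; apply.
    by rewrite nrm_distC => /W; apply.
  by move=> _ hn; apply: le_lt_trans (cau _ _ le_nm) (hN _ hn).
exists v => n; rewrite leNgt; apply/negP => lt_v.
have [N hN] : exists N, forall k, (N <= k)%N -> nrm (u k - v) < nrm (u n - v) - 2 * C / 2 ^+ n.
  by apply: hv; rewrite subr_gt0.
have := hN (maxn N n) (leq_maxl _ _).
have := cau _ _ (leq_maxr N n).
have := nrm_dist_triangle (u (maxn N n)) (u n) v.
rewrite (nrm_distC (u n) (u _)); lra.
Qed.

(** Neumann series. The offset [k] lets the decay start late, as in [quasinil_perturbation], where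
    [k] is the length of the annihilating words. *)
Lemma invertible_of_half_pow x C k :
  (forall n, nrm (x ^+ (k + n)) <= C / 2 ^+ n) -> invertible (1 - x).
Proof.
move=> h; pose S n := \sum_(i < k + n) x ^+ i.
have dS n : nrm (S n.+1 - S n) <= C / 2 ^+ n.
  by rewrite /S addnS big_ord_recr /= addrAC subrr add0r.
have [l hl] := geometric_limit dS.
have mS n : (1 - x) * S n = 1 - x ^+ (k + n) /\ S n * (1 - x) = 1 - x ^+ (k + n).
  have e : (1 - x) * S n = 1 - x ^+ (k + n).
    by rewrite -opprB mulNr /S -subrX1 opprB.
  split=> //; rewrite -e; apply: commr_sym; apply: commr_sum => i _.
  by apply: commrX; apply: commr_sym; apply: commrB (commr1 _) (commr_refl _).
exists l; split; apply: subr0_eq; apply: (@le_half_pow_eq0 _ (nrm (1 - x) * (2 * C) + C)) => n.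
- have -> : (1 - x) * l - 1 = (1 - x) * (l - S n) - x ^+ (k + n).
    by rewrite mulrBr (mS n).1; ncring.
  apply: le_trans (nrmB _ _) _; rewrite [leRHS]mulrDl; apply: lerD => //.
  by apply: le_trans (nM _ _) _; rewrite -mulrA nrm_distC ler_wpM2l.
- have -> : l * (1 - x) - 1 = (l - S n) * (1 - x) - x ^+ (k + n).
    by rewrite mulrBl (mS n).2; ncring.
  apply: le_trans (nrmB _ _) _; rewrite [leRHS]mulrDl; apply: lerD => //.
  by apply: le_trans (nM _ _) _; rewrite mulrC -mulrA nrm_distC ler_wpM2l.
Qed.

(** The condition lim |x^n|^(1/n) = 0 without roots or limits; [quasinilpotentP] identifies it with
    the spectral definition. *)
Definition quasinil x := forall e, 0 < e -> exists C, forall n, nrm (x ^+ n) <= C * e ^+ n.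

Lemma quasinil_invertible x : quasinil x -> invertible (1 - x).
Proof.
have h0 : 0 < 2^-1 :> R by rewrite invr_gt0.
move=> /(_ _ h0)[C hC]; apply: (@invertible_of_half_pow _ C 0) => n.
by rewrite -exprVn.
Qed.

Lemma quasinilM x y : GRing.comm x y -> quasinil x -> quasinil (x * y).
Proof.
move=> cxy qx e e0.
(* This rate absorbs |y|^n; the added 1 keeps the denominator positive. *)
have d0 : 0 < e / (1 + nrm y) by rewrite divr_gt0 // ltr_pwDl.
have [C hC] := qx _ d0; exists C => n.
have C0 : 0 <= C by have := hC 0%N; rewrite !expr0 n1 mulr1; exact: le_trans.
rewrite exprMn_comm //; apply: le_trans (nM _ _) _.
apply: le_trans (ler_pM (ge0 _) (ge0 _) (hC n) (nrmX _ _)) _.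
have y0 := ge0 y.
rewrite -mulrA -exprMn ler_wpM2l // lerXn2r ?nnegrE ?(mulr_ge0 (ltW d0)) ?(ltW e0) //.
by rewrite mulrAC ler_pdivrMr ?ltr_pwDl // ler_wpM2l ?(ltW e0) // lerDr.
Qed.

Lemma quasinilMl x y : GRing.comm x y -> quasinil y -> quasinil (x * y).
Proof. by move=> c; rewrite c; apply: quasinilM; apply: commr_sym. Qed.

Lemma quasinilN x : quasinil x -> quasinil (- x).
Proof. by move=> qx; rewrite -mulrN1; apply: quasinilM => //; apply: commrN1. Qed.

Lemma quasinilZ l x : quasinil x -> quasinil (l *: x).
Proof.
move=> qx; rewrite -mulr_algl; apply: quasinilMl => //; exact: comm_alg.
Qed.

(** Binomial formula: the rates [e / 2] for both summands resum to [e ^+ n]. *)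
Lemma quasinilD x y : GRing.comm x y -> quasinil x -> quasinil y -> quasinil (x + y).
Proof.
move=> cxy qx qy e e0.
have d0 : 0 < e / 2 by rewrite divr_gt0.
have [C hC] := qx _ d0; have [D hD] := qy _ d0.
have C0 : 0 <= C by have := hC 0%N; rewrite !expr0 n1 mulr1; exact: le_trans.
exists (C * D) => n; rewrite exprDn_comm //.
apply: le_trans (nrm_sum _ _ _) _.
have -> : C * D * e ^+ n = C * D * \sum_(i < n.+1) (e / 2) ^+ (n - i) * (e / 2) ^+ i *+ 'C(n, i).
  by rewrite -exprDn -splitr.
rewrite mulr_sumr; apply: ler_sum => i _.
apply: le_trans (nrmMn _ _) _; rewrite mulrnAr lerMn2r; apply/orP; right.
apply: le_trans (nM _ _) _; apply: le_trans (ler_pM (ge0 _) (ge0 _) (hC _) (hD _)) _.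
by rewrite le_eqVlt; apply/orP; left; apply/eqP; ring.
Qed.

Lemma quasinilB x y : GRing.comm x y -> quasinil x -> quasinil y -> quasinil (x - y).
Proof. by move=> c qx qy; apply: quasinilD (quasinilN qy) => //; apply: commrN. Qed.


(** * Bounds on the resolvent *)

Definition inverses x y := x * y = 1 /\ y * x = 1.

(** Comes from [x - 1 = (x - 1) * (1 - y) + (1 - y)]; the product form postpones the division until
    [d] is a concrete number. *)
Lemma nrm_inverse_near1 x y (d : R) :
  x * y = 1 -> nrm (y - 1) <= d -> nrm (x - 1) * (1 - d) <= d.
Proof.
move=> xy hd; have e : x - 1 = (x - 1) * (1 - y) + (1 - y).
  by rewrite mulrBl mul1r mulrBr xy; ncring.
have h := nD ((x - 1) * (1 - y)) (1 - y); rewrite -e (nrm_distC 1) in h.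
have h2 := nM (x - 1) (1 - y); rewrite (nrm_distC 1) in h2.
have := ler_wpM2l (ge0 (x - 1)) hd; lra.
Qed.

Section Resolvent.
Variables (x : A) (res : R[i] -> A).
Hypothesis resP : forall l, inverses (1 - l *: x) (res l).

Lemma resolvent_identity l (m : R[i]) : res l - res m = (l - m) *: (res l * x * res m).
Proof.
transitivity (res l * ((1 - m *: x) - (1 - l *: x)) * res m).
  by rewrite mulrBr mulrBl (resP l).2 -mulrA (resP m).1 mulr1 mul1r.
have -> : (1 - m *: x) - (1 - l *: x) = (l - m) *: x by rewrite scalerBl; ncring.
by rewrite -scalerAr -scalerAl.
Qed.

Lemma resolvent_dist l (m : R[i]) :
  nrm (res l - res m) <= cnorm (l - m) * (nrm (res l) * nrm x * nrm (res m)).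
Proof.
rewrite resolvent_identity nZ ler_wpM2l ?cnorm_ge0 //.
by apply: le_trans (nM _ _) _; rewrite ler_wpM2r.
Qed.

(** By the resolvent identity, |res l| <= |res m| + |res l| / 2. *)
Lemma resolvent_locally_bounded l (m : R[i]) :
  cnorm (l - m) * (nrm x * nrm (res m)) <= 2^-1 -> nrm (res l) <= 2 * nrm (res m).
Proof.
move=> h; have h1 := resolvent_dist l m; have h2 := nD (res l - res m) (res m).
have := ler_wpM2l (ge0 (res l)) h; rewrite subrK in h2 *.
have -> : nrm (res l) * (cnorm (l - m) * (nrm x * nrm (res m))) =
  cnorm (l - m) * (nrm (res l) * nrm x * nrm (res m)) by ring.
by lra.
Qed.

Lemma cnorm_le_sum (a b : R) : cnorm (a +i* b)%C <= `|a| + `|b|.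
Proof.
rewrite /cnorm /= -[leRHS]ger0_norm ?addr_ge0 // -sqrtr_sqr ler_sqrt ?sqr_ge0 //.
rewrite sqrrD !real_normK ?num_real // addrAC lerDl.
by rewrite mulrn_wge0 ?mulr_ge0.
Qed.

Lemma le_cnorm_Re_Im (a b T : R) :
  cnorm (a +i* b)%C <= T -> (- T <= a <= T) /\ (- T <= b <= T).
Proof.
rewrite /cnorm /= -!ler_norml => h.
by split; apply: le_trans h; rewrite -sqrtr_sqr ler_sqrt ?addr_ge0 ?sqr_ge0 //
  ?lerDl ?lerDr ?sqr_ge0.
Qed.

Lemma resolvent_bounded (T : R) :
  exists M, forall l, cnorm l <= T -> nrm (res l) <= M.
Proof.
pose g (w : R * R) := res (w.1 +i* w.2)%C.
have cK : compact (`[- T, T]%classic `*` `[- T, T]%classic).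
  by apply: compact_setX; exact: segment_compact.
(* Local bounds become uniform on the square, which contains the disc; with the filter at +oo, every
   large enough [M] is a bound. *)
move/compact_near_coveringP: cK => /(_ R (+oo)%R (fun M w => nrm (g w) <= M)).
case=> [w _|M [_ hM]].
  pose c := 1 + nrm x * nrm (g w).
  have c0 : 0 < c by rewrite ltr_pwDl // mulr_ge0.
  (* Points of the ball lie within [2 * d] of the centre in modulus, and [2 * d * c] is the 1/2
     required by the local bound. *)
  pose d := (4 * c)^-1; have d0 : 0 < d by rewrite invr_gt0 mulr_gt0.
  exists (ball w d, [set M | 2 * nrm (g w) <= M]%classic) => /=.
    split; [exact: nbhsx_ballx | apply: nbhs_pinfty_ge; exact: num_real].
  case=> w' M [/= [h1 h2] hM]; apply: le_trans hM.
  apply: resolvent_locally_bounded.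
  have {}h1 : `|w'.1 - w.1| < d by rewrite distrC.
  have {}h2 : `|w'.2 - w.2| < d by rewrite distrC.
  have h3 : cnorm ((w'.1 +i* w'.2) - (w.1 +i* w.2))%C <= 2 * d.
    by apply: le_trans (cnorm_le_sum _ _) _; lra.
  apply: (@le_trans _ _ (2 * d * c)).
    by rewrite ler_pM ?cnorm_ge0 ?mulr_ge0 // lerDr.
  by rewrite /d invfM -!mulrA mulVf ?gt_eqF //; lra.
exists (M + 1) => -[a b] /le_cnorm_Re_Im [ha hb].
apply: (hM (M + 1) _ (a, b)); first by rewrite ltrDl.
by split; rewrite /= in_itv.
Qed.

End Resolvent.

(** * Elements without nonzero spectrum *)

Lemma unit_root_neg1 n : (0 < n)%N -> exists2 w : R[i], w ^+ n = -1 & cnorm w = 1.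
Proof.
move=> n0; exists (n.-root (-1)); rewrite ?rootCK //.
apply/eqP; rewrite -(@pexpr_eq1 _ _ n) ?cnorm_ge0 -?lt0n //.
by rewrite -cnormX rootCK // cnormN1.
Qed.

(* Rickart's averaging over the roots of unity of order [2 ^ i], one square
   root at a time: [(1 - y^2)^-1] is the mean of [(1 - y)^-1] and [(1 + y)^-1]. *)
Lemma dyadic_resolvent_close x l (m : R[i]) (c : R) :
  (forall u, cnorm u = 1 -> exists U V,
     [/\ inverses (1 - (u * l) *: x) U, inverses (1 - (u * m) *: x) V & nrm (U - V) <= c]) ->
  forall i u, cnorm u = 1 -> exists U V,
    [/\ inverses (1 - ((u * l) *: x) ^+ (2 ^ i)) U,
        inverses (1 - ((u * m) *: x) ^+ (2 ^ i)) V & nrm (U - V) <= c].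
Proof.
move=> h0; elim=> [|i IH] u u1; first by have [U [V]] := h0 u u1; exists U, V; rewrite !expr1.
(* Since [w ^+ (2 ^ i) = -1], the induction hypothesis at [w * u] inverts [1 + y] where at [u] it
   inverts [1 - y]. *)
have [w wi w1] := @unit_root_neg1 (2 ^ i) (expn_gt0 2 i).
have [U1 [V1 [hU1 hV1 h1]]] := IH u u1.
have [|U2 [V2 [hU2 hV2 h2]]] := IH (w * u); first by rewrite cnormM w1 u1 mulr1.
have sgn (k : R[i]) : ((w * u * k) *: x) ^+ (2 ^ i) = - ((u * k) *: x) ^+ (2 ^ i).
  by rewrite -mulrA -scalerA exprZn wi scaleN1r.
move: hU2 hV2; rewrite !sgn !opprK => hU2 hV2.
have mean y W1 W2 : inverses (1 - y) W1 -> inverses (1 + y) W2 ->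
    inverses (1 - y ^+ 2) (2^-1 *: (W1 + W2)).
  move=> [a1 a2] [b1 b2].
  have e1 : 1 - y ^+ 2 = (1 + y) * (1 - y) by rewrite expr2; ncring.
  have e2 : 1 - y ^+ 2 = (1 - y) * (1 + y) by rewrite expr2; ncring.
  have two : (1 + y) + (1 - y) = (2 : R[i]) *: 1.
    by rewrite scaler_nat; change 2%N with (1 + 1)%N; rewrite mulrnDr mulr1n; ncring.
  split.
    by rewrite -scalerAr mulrDr {1}e1 e2 -!mulrA a1 b1 !mulr1 two scalerA mulVf ?pnatr_eq0 ?scale1r.
  by rewrite -scalerAl mulrDl {1}e2 e1 !mulrA a2 b2 !mul1r two scalerA mulVf ?pnatr_eq0 ?scale1r.
exists (2^-1 *: (U1 + U2)), (2^-1 *: (V1 + V2)); rewrite expnSr !exprM.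
split; [exact: mean | exact: mean |].
rewrite -scalerBr nZ cnorm_half.
have -> : U1 + U2 - (V1 + V2) = (U1 - V1) + (U2 - V2) by ncring.
by have := nD (U1 - V1) (U2 - V2); lra.
Qed.

(** Only exponents [2 ^ i] occur because the averaging proceeds by successive square roots. *)
Definition dyadic_small x (r : R) := exists i, r ^+ (2 ^ i) * nrm (x ^+ (2 ^ i)) <= 2^-1.

Lemma nrm_scaled_pow x (r : R) n : 0 <= r ->
  nrm (((r%:C)%C *: x) ^+ n) = r ^+ n * nrm (x ^+ n).
Proof. by move=> r0; rewrite exprZn nZ cnormX cnorm_real ger0_norm. Qed.

(** Smallness at [r] puts an averaged inverse near 1; the one at [s] is uniformly close to it, hence
    also near 1, which makes a power of [s x] small. The step [d] depends on [T] and not on [r]. *)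
Lemma dyadic_small_step x (T : R) : (forall l, invertible (1 - l *: x)) ->
  exists2 d : R, 0 < d & forall r s, 0 <= r -> r <= s -> s <= r + d -> s <= T ->
    dyadic_small x r -> dyadic_small x s.
Proof.
move=> inv; have [res resP] : {res | forall l, inverses (1 - l *: x) (res l)}.
  by have [f hf] := choice inv; exists f.
have [M hM] := resolvent_bounded resP T.
pose K := M * nrm x * M + 1.
have [T0|T0] := leP 0 T; last first.
  by exists 1 => // r s r0 rs _ sT; have := lt_le_trans T0 (le_trans r0 (le_trans rs sT)); rewrite ltxx.
have M0 : 0 <= M by apply: le_trans (hM 0 _); rewrite // /cnorm ComplexField.Normc.normc0.
have K0 : 0 < K by rewrite ltr_pwDr // !mulr_ge0.
(* [K] dominates the Lipschitz constant of the resolvent on the disc of radius [T]; the factor 7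
   yields the closeness 1/7 used below. *)
exists (7 * K)^-1; first by rewrite invr_gt0 mulr_gt0.
move=> r s r0 rs sd sT [i hi].
have s0 : 0 <= s := le_trans r0 rs.
have close u : cnorm u = 1 -> exists U V,
    [/\ inverses (1 - (u * (s%:C)%C) *: x) U, inverses (1 - (u * (r%:C)%C) *: x) V
      & nrm (U - V) <= 7^-1].
  move=> u1; exists (res (u * (s%:C)%C)), (res (u * (r%:C)%C)); split=> //.
  apply: le_trans (resolvent_dist resP _ _) _.
  rewrite -mulrBr cnormM u1 mul1r -rmorphB cnorm_real ger0_norm ?subr_ge0 //.
  have b1 : nrm (res (u * (s%:C)%C)) <= M by apply: hM; rewrite cnormM u1 mul1r cnorm_real ger0_norm.
  have b2 : nrm (res (u * (r%:C)%C)) <= M.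
    by apply: hM; rewrite cnormM u1 mul1r cnorm_real ger0_norm // (le_trans rs).
  apply: (@le_trans _ _ ((7 * K)^-1 * K)); last by rewrite invfM -mulrA mulVf ?gt_eqF // mulr1.
  apply: ler_pM; rewrite ?subr_ge0 ?mulr_ge0 //; first lra.
  rewrite /K; apply: ler_wpDr => //; apply: ler_pM => //; first by rewrite mulr_ge0.
  by rewrite ler_wpM2r.
(* Two further squarings lower 1/2 to 1/16. Then |V - 1| <= 1/15, |U - 1| <= 1/15 + 1/7 <= 2/7, and
   the power of [s x] has norm at most 2/5. *)
have [U [V [[hU _] [_ hV] hUV]]] := dyadic_resolvent_close close (i.+2) cnorm1.
rewrite !mul1r in hU hV.
have small : nrm (((r%:C)%C *: x) ^+ (2 ^ i.+2)) <= 16^-1.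
  rewrite !expnSr -mulnA exprM; apply: le_trans (nrmX _ _) _.
  rewrite nrm_scaled_pow //.
  have -> : 16^-1 = 2^-1 ^+ (2 * 2) :> R by rewrite exprVn; congr (_^-1); rewrite -natrX.
  by rewrite lerXn2r ?nnegrE ?invr_ge0 ?mulr_ge0 ?exprn_ge0.
exists i.+2; rewrite -nrm_scaled_pow //.
set y := _ ^+ _ in hU *; set t := _ ^+ _ in hV small.
have h1 : nrm (V - 1) * (1 - 16^-1) <= 16^-1.
  by apply: nrm_inverse_near1 hV _; rewrite addrAC subrr add0r nrmN.
have h2 : nrm (U - 1) <= 2 / 7.
  by have := nrm_dist_triangle V U 1; lra.
have := nrm_inverse_near1 hU h2.
by rewrite addrAC subrr add0r nrmN; lra.
Qed.

(** From [r = 0], where smallness is trivial, [N] steps of length [T / N < d] reach [T]. *)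
Lemma dyadic_small_all x : (forall l, invertible (1 - l *: x)) ->
  forall T, 0 < T -> dyadic_small x T.
Proof.
move=> inv T T0; have [d d0 step] := dyadic_small_step T inv.
pose N := (Num.bound (T / d)).+1.
have hN : T / N%:R < d.
  rewrite ltr_pdivrMr ?ltr0n // mulrC -ltr_pdivrMr //.
  apply: lt_trans (archi_boundP _) _; first by rewrite divr_ge0 ?ltW.
  by rewrite ltr_nat.
have Nn0 : N%:R != 0 :> R by rewrite pnatr_eq0.
have h k : (k <= N)%N -> dyadic_small x (T / N%:R * k%:R).
  have t0 : 0 < T / N%:R by rewrite divr_gt0 ?ltr0n.
  elim: k => [_|k IH kN].
    by exists 0%N; rewrite mulr0 !expr1 mul0r invr_ge0.
  apply: (step (T / N%:R * k%:R)); last by apply: IH; exact: ltnW.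
  - by rewrite mulr_ge0 // ltW.
  - by rewrite ler_pM2l // ler_nat.
  - by rewrite -natr1 mulrDr mulr1 lerD2l ltW.
  - rewrite -[leRHS](mulfVK Nn0); rewrite ler_pM2l //.
    by rewrite ler_nat.
by have := h N (leqnn _); rewrite mulfVK.
Qed.

(** Smallness at radius [e^-1] gives |x^N| <= e^N for one [N]; dividing [n] by [N] extends this to
    all powers, the remainder going into the constant. *)
Lemma quasinil_of_spectrum x : (forall l, invertible (1 - l *: x)) -> quasinil x.
Proof.
move=> inv e e0; have ei : 0 < e^-1 by rewrite invr_gt0.
have [i hi] := dyadic_small_all inv ei.
set N := (2 ^ i)%N in hi; have N0 : (0 < N)%N by rewrite expn_gt0.
have {}hi : nrm (x ^+ N) <= e ^+ N.
  move: hi; rewrite exprVn mulrC ler_pdivrMr ?exprn_gt0 // => h.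
  by apply: le_trans h _; have := exprn_gt0 N e0; lra.
exists ((1 + nrm x / e) ^+ N) => n; rewrite (divn_eq n N) mulnC.
rewrite exprD exprM; apply: le_trans (nM _ _) _.
have a1 : nrm ((x ^+ N) ^+ (n %/ N)) <= e ^+ (N * (n %/ N)).
  by apply: le_trans (nrmX _ _) _; rewrite exprM lerXn2r ?nnegrE ?exprn_ge0 ?(ltW e0).
have a2 : nrm (x ^+ (n %% N)) <= (1 + nrm x / e) ^+ N * e ^+ (n %% N).
  apply: le_trans (nrmX _ _) _.
  apply: (@le_trans _ _ ((1 + nrm x / e) ^+ (n %% N) * e ^+ (n %% N))).
    rewrite -exprMn lerXn2r ?nnegrE ?mulr_ge0 ?addr_ge0 ?divr_ge0 ?(ltW e0) //.
    by rewrite mulrDl mulfVK ?gt_eqF // lerDr mul1r ltW.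
  rewrite ler_wpM2r ?exprn_ge0 ?(ltW e0) // ler_weXn2l //; last by rewrite ltnW // ltn_mod.
  by rewrite lerDl divr_ge0 // ltW.
by apply: le_trans (ler_pM _ _ a1 a2) _; rewrite // exprD mulrCA.
Qed.

(** * Square roots near 1 *)

Lemma invertibleZ l x : l != 0 -> invertible x -> invertible (l *: x).
Proof.
move=> l0 [y [xy yx]]; exists (l^-1 *: y).
by rewrite -!scalerAl -!scalerAr xy yx !scalerA mulfV // mulVf // scale1r.
Qed.

Lemma invertibleM x y : invertible x -> invertible y -> invertible (x * y).
Proof.
move=> [u [xu ux]] [v [yv vy]]; exists (v * u); split.
  by rewrite mulrA -(mulrA x) yv mulr1.
by rewrite mulrA -(mulrA v) ux mulr1.
Qed.

Lemma invertible_comm_factor x y : GRing.comm x y -> invertible (x * y) -> invertible x.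
Proof.
move=> c [u [h1 h2]]; exists (y * u).
have h3 : u * y * x = 1 by rewrite -mulrA -c.
split; first by rewrite mulrA.
rewrite -[LHS]mul1r -{1}h3.
have -> : u * y * x * (y * u * x) = u * y * (x * y * u) * x by rewrite !mulrA.
by rewrite h1 mulr1.
Qed.

Lemma comm_inverse x y u : u * x = 1 -> x * u = 1 -> GRing.comm x y -> GRing.comm u y.
Proof.
move=> ux xu c; transitivity (u * (y * x) * u); first by rewrite -!mulrA xu mulr1.
by rewrite -c !mulrA ux mul1r.
Qed.

(** The rate to request from a quasinilpotent so that it beats the powers of an element of norm [t]
    with a factor 2^-n to spare. *)
Lemma le_half_pow_mul C (t : R) n : 0 <= C -> 0 <= t ->
  C * (2 * (t + 1))^-1 ^+ n * t ^+ n <= C / 2 ^+ n.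
Proof.
move=> C0 t0; have t1 : 0 < t + 1 by rewrite ltr_wpDl.
rewrite -mulrA -exprMn -exprVn ler_wpM2l // lerXn2r ?nnegrE ?invr_ge0 //.
  by rewrite mulr_ge0 // invr_ge0 mulr_ge0 // ltW.
by rewrite invfM -mulrA ler_piMr ?invr_ge0 // mulrC ler_pdivrMr // mul1r lerDl.
Qed.

(** An inverse [y] would give 1 = x^n y^n, whose norm tends to 0. *)
Lemma quasinil_not_invertible x : quasinil x -> ~ invertible x.
Proof.
move=> qx [y [xy yx]].
have c0 : 0 < 2 * (nrm y + 1) by rewrite mulr_gt0 // ltr_wpDl.
have [C hC] : exists C, forall n, nrm (x ^+ n) <= C * (2 * (nrm y + 1))^-1 ^+ n.
  by apply: qx; rewrite invr_gt0.
have C0 : 0 <= C by have := hC 0%N; rewrite !expr0 n1 mulr1; exact: le_trans.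
suff h : (1 : A) = 0 by have := n1; rewrite h nrm0 => /esym/eqP; rewrite oner_eq0.
apply: (@le_half_pow_eq0 _ C) => n.
have {1}-> : 1 = x ^+ n * y ^+ n by rewrite -exprMn_comm ?xy ?expr1n //; rewrite /GRing.comm xy.
apply: le_trans (nM _ _) _; apply: le_trans (ler_pM (ge0 _) (ge0 _) (hC n) (nrmX _ _)) _.
exact: le_half_pow_mul.
Qed.

Lemma quasinilpotentP x : quasinilpotent x <-> quasinil x.
Proof.
split=> [sx|qx].
  apply: quasinil_of_spectrum => l; have [->|l0] := eqVneq l 0.
    by rewrite scale0r subr0; exists 1; rewrite mulr1.
  have -> : 1 - l *: x = l *: (l^-1%:A - x) by rewrite scalerBr scalerA mulfV // scale1r.
  apply: invertibleZ => //; apply: contrapT => h.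
  have : spectrum x l^-1 by [].
  by rewrite sx /= => /eqP; rewrite invr_eq0 (negPf l0).
apply/seteqP; split=> l /=.
  move=> h; apply: contrapT => /eqP l0; apply: h.
  have -> : l%:A - x = l *: (1 - l^-1 *: x) by rewrite scalerBr scalerA mulfV // scale1r.
  by apply: invertibleZ => //; apply: quasinil_invertible; exact: quasinilZ.
move=> ->; rewrite /spectrum /= scale0r sub0r; apply: quasinil_not_invertible; exact: quasinilN.
Qed.

(* [x |-> sup_n |x z^n| 2^n] is a seminorm for which multiplication by the
   quasinilpotent [z] has operator bound [1/2]; [opbound z x M] says that
   multiplication by [x] has operator bound [M] for it. *)
Definition opbound z x M := forall y C, GRing.comm y z ->
  (forall n, nrm (y * z ^+ n) <= C / 2 ^+ n) ->
  forall n, nrm (x * y * z ^+ n) <= M * C / 2 ^+ n.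

Lemma opbound_self z : opbound z z 2^-1.
Proof.
move=> y C c h n; rewrite -c -mulrA -exprS; apply: le_trans (h _) _.
by rewrite exprS invfM mulrCA mulrA.
Qed.

Lemma opboundM z x y (M N : R) : GRing.comm y z ->
  opbound z x M -> opbound z y N -> opbound z (x * y) (M * N).
Proof.
move=> c hx hy w C cw h n; rewrite -(mulrA x) -[M * N * C]mulrA.
apply: hx; last by move=> k; exact: hy.
by apply: commr_sym; apply: commrM; apply: commr_sym.
Qed.

Lemma opboundD z x y (M N : R) : opbound z x M -> opbound z y N -> opbound z (x + y) (M + N).
Proof.
move=> hx hy w C cw h n; rewrite !mulrDl; apply: le_trans (nD _ _) _.
by apply: lerD; [exact: hx | exact: hy].
Qed.

Lemma opboundZ z l x M : opbound z x M -> opbound z (l *: x) (cnorm l * M).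
Proof.
move=> hx w C cw h n; rewrite -2!scalerAl nZ.
have -> : cnorm l * M * C / 2 ^+ n = cnorm l * (M * C / 2 ^+ n) by rewrite !mulrA.
by rewrite ler_wpM2l ?cnorm_ge0 //; exact: hx.
Qed.

Lemma opbound0 z : opbound z 0 0.
Proof. by move=> w C cw h n; rewrite !mul0r nrm0. Qed.

Lemma opbound_le z x (M N : R) : M <= N -> opbound z x M -> opbound z x N.
Proof.
move=> MN hx w C cw h n; apply: le_trans (hx w C cw h n) _.
have C0 : 0 <= C by have := h 0%N; rewrite !expr0 divr1; exact: le_trans.
by rewrite -!mulrA ler_wpM2r // mulr_ge0 // invr_ge0 exprn_ge0.
Qed.

Lemma opbound_nrm z C : (forall n, nrm (z ^+ n) <= C / 2 ^+ n) ->
  forall x M, opbound z x M -> nrm x <= M * C.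
Proof.
move=> hz x M /(_ 1 C (commr_sym (commr1 _))) h.
have := h _ 0%N; rewrite !expr0 !mulr1 divr1; apply=> n.
by rewrite mul1r.
Qed.

Lemma opboundX z x M : GRing.comm x z -> opbound z x M -> forall n, opbound z (x ^+ n) (M ^+ n).
Proof.
move=> c hx; elim=> [|n IH].
  by move=> w C cw h n; rewrite !expr0 !mul1r.
rewrite !exprS; apply: opboundM => //.
by apply: commr_sym; apply: commrX; apply: commr_sym.
Qed.

Lemma le_of_half_pow (a b C : R) : (forall n, a <= b + C / 2 ^+ n) -> a <= b.
Proof.
move=> h; rewrite leNgt; apply/negP; rewrite -subr_gt0 => ab.
have [N hN] := half_pow_lt C ab.
by have := hN N (leqnn _); have := h N; lra.
Qed.

Lemma opbound_limit z (u : nat -> A) y M D : (forall n, opbound z (u n) M) ->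
  (forall n, nrm (u n - y) <= D / 2 ^+ n) -> opbound z y M.
Proof.
move=> bu hy w C cw h n; apply: (@le_of_half_pow _ _ (D * nrm (w * z ^+ n))) => k.
have -> : y * w * z ^+ n = u k * w * z ^+ n - (u k - y) * (w * z ^+ n) by ncring.
apply: le_trans (nrmB _ _) _; apply: lerD; first exact: bu.
by apply: le_trans (nM _ _) _; rewrite mulrAC ler_wpM2r.
Qed.

(** Fixed-point iteration for [y = (z - y^2) / 2], that is [(1 + y)^2 = 1 + z], in the seminorm
    where [z] has size 1/2. Quasinilpotency follows from [y = z (2 + y)^-1]. *)
Lemma quasinil_sqrt z : quasinil z -> exists y,
  [/\ (1 + y) * (1 + y) = 1 + z, quasinil y & forall x, GRing.comm x z -> GRing.comm x y].
Proof.
move=> qz; have [C hC] : exists C, forall n, nrm (z ^+ n) <= C / 2 ^+ n.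
  have [|C hC] := qz 2^-1; first by rewrite invr_gt0.
  by exists C => n; rewrite -exprVn.
pose u n := iter n (fun y => 2^-1 *: (z - y * y)) 0.
have u0 : u 0%N = 0 by [].
have uS n : u n.+1 = 2^-1 *: (z - u n * u n) by [].
have cu x : GRing.comm x z -> forall n, GRing.comm x (u n).
  move=> c; elim=> [|n IH]; first exact: commr0.
  rewrite uS -mulr_algl; apply: commrM; first by apply: commr_sym; exact: comm_alg.
  by apply: commrB => //; apply: commrM.
have cuz n : GRing.comm (u n) z by apply: commr_sym; exact: cu.
have buB y (M : R) : opbound z y M -> opbound z (- y) M.
  by rewrite -scaleN1r => /(opboundZ (-1)); rewrite cnormN1 mul1r.
(* The ball of radius 1/2 is stable: (1/2 + 1/4) / 2 = 3/8. *)
have bu n : opbound z (u n) 2^-1.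
  elim: n => [|n IH]; first by rewrite u0; apply: (@opbound_le _ _ 0); [rewrite invr_ge0 | exact: opbound0].
  have bd' := (opboundZ 2^-1 (opboundD (@opbound_self z)
     (buB _ _ (opboundM (cuz n) IH IH)))).
  rewrite uS; apply: (opbound_le _ bd'); rewrite cnorm_half; lra.
(* Difference of squares: [u n.+1 + u n] has bound 1, and the halving contracts by 1/2. *)
have bd n : opbound z (u n.+1 - u n) (2^-1 ^+ n).
  elim: n => [|n IH].
    by rewrite expr0 u0 subr0; apply: (opbound_le _ (bu 1%N)); lra.
  have -> : u n.+2 - u n.+1 = - (2^-1 *: ((u n.+1 + u n) * (u n.+1 - u n))).
    rewrite {1}(uS n.+1) {2}(uS n) -scalerBr -scalerN; congr (_ *: _).
    have c : u n.+1 * u n = u n * u n.+1 by apply: cu; exact: cuz.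
    by rewrite mulrDl !mulrBr c; ncring.
  apply: buB; apply: opbound_le _ (opboundZ _ (opboundM _ (opboundD (bu n.+1) (bu n)) IH)).
    by rewrite cnorm_half exprS; have := exprn_ge0 n (_ : 0 <= 2^-1 :> R); lra.
  by apply: commr_sym; apply: commrB; exact: cu.
have [|y hy] := @geometric_limit u C.
  by move=> n; rewrite mulrC -exprVn; exact: opbound_nrm (bd n).
have cy x : GRing.comm x z -> GRing.comm x y.
  move=> c; apply: subr0_eq; apply: (@le_half_pow_eq0 _ (2 * nrm x * (2 * C))) => n.
  have -> : x * y - y * x = (u n - y) * x - x * (u n - y).
    by rewrite mulrBl mulrBr (cu _ c n); ncring.
  apply: le_trans (nrmB _ _) _.
  have := nM (u n - y) x; have := nM x (u n - y); have := ler_wpM2l (ge0 x) (hy n).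
  by rewrite (mulrC (nrm (u n - y))) -[2 * nrm x * _ / _]mulrA -[2 * nrm x * _]mulrA; lra.
have cyz : GRing.comm y z by apply: commr_sym; exact: cy.
have yE : y = 2^-1 *: (z - y * y).
  apply: subr0_eq.
  have nu n : nrm (u n) <= 2^-1 * C by exact: opbound_nrm (bu n).
  apply: (@le_half_pow_eq0 _ (2 * C + 2^-1 * ((2^-1 * C + nrm y) * (2 * C)))) => n.
  have -> : y - 2^-1 *: (z - y * y) = - (u n.+1 - y) + - (2^-1 *: ((u n + y) * (u n - y))).
    have c : u n * y = y * u n by apply: cy; exact: cuz.
    have -> : (u n + y) * (u n - y) = u n * u n - y * y by rewrite mulrDl !mulrBr c; ncring.
    by rewrite uS !scalerBr; ncring.
  apply: le_trans (nD _ _) _; rewrite !nrmN nZ cnorm_half [leRHS]mulrDl.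
  apply: lerD.
    apply: le_trans (hy _) _; rewrite exprS invfM.
    have := le_trans (ge0 _) (hy n); lra.
  rewrite -mulrA ler_wpM2l ?invr_ge0 //; apply: le_trans (nM _ _) _.
  rewrite -mulrA; apply: ler_pM => //; apply: le_trans (nD _ _) _.
  by rewrite lerD2r.
have sq : y * (y + 2%:R) = z.
  have : (2 : R[i]) *: y = z - y * y by rewrite {1}yE scalerA mulfV ?pnatr_eq0 // scale1r.
  by rewrite scaler_nat mulrDr mulr_natr => ->; rewrite addrC subrK.
exists y; split=> //.
  by rewrite mulrDl mul1r mulrDr mulr1 -addrA -sq mulrDr mulr_natr mulr2n; ncring.
(* [y] inherits the bound 1/2 from the iterates, so the powers of [y / 2] decay fast enough to
   invert [1 + y / 2]. *)
have by_ n : nrm ((- (2^-1 *: y)) ^+ (0 + n)) <= C / 2 ^+ n.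
  have := opbound_nrm hC (opboundX (commr_sym _) (buB _ _ (opboundZ 2^-1 (opbound_limit bu hy))) n).
  rewrite add0n cnorm_half; move=> h; apply: le_trans (h _) _.
    by apply: commrN; rewrite -mulr_algl; apply: commrM; [exact: commr_sym (comm_alg _ _) | exact: cy].
  have C0 : 0 <= C by have := hC 0%N; rewrite !expr0 divr1; exact: le_trans.
  rewrite mulrC ler_wpM2l // -exprVn lerXn2r ?nnegrE ?mulr_ge0 ?invr_ge0 //; lra.
have [v [v1 v2]] := invertible_of_half_pow by_.
rewrite opprK in v1 v2.
have e2 : y + 2%:R = 2%:R *: (1 + 2^-1 *: y).
  by rewrite scalerDr scalerA mulfV ?pnatr_eq0 // scale1r scaler_nat addrC.
have -> : y = 2^-1 *: (z * v).
  rewrite -sq e2 -scalerAr -scalerAl scalerA mulVf ?pnatr_eq0 // scale1r.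
  by rewrite -mulrA v1 mulr1.
apply: quasinilZ; apply: quasinilM => //; apply: commr_sym.
apply: comm_inverse v2 v1 _; apply: commr_sym; apply: commrD; first exact: commr1.
by rewrite -mulr_algl; apply: commrM; [exact: commr_sym (comm_alg _ _) | exact: commr_sym].
Qed.

(** * Quasinilpotency of [x - x ^+ N.+1] *)

Lemma quasinil0 : quasinil 0.
Proof.
move=> e e0; exists 1 => -[|n]; first by rewrite !expr0 n1 mulr1.
by rewrite expr0n /= nrm0 mul1r exprn_ge0 ?ltW.
Qed.

Definition hirano N x := quasinil (x - x ^+ N.+1).

(** Brings exponents to a common multiple when corners are glued; the difference telescopes. *)
Lemma hiranoM N x j : hirano N x -> hirano (N * j) x.
Proof.
move=> h; elim: j => [|j IH]; first by rewrite /hirano muln0 expr1 subrr; exact: quasinil0.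
rewrite /hirano.
have -> : x - x ^+ (N * j.+1).+1 = (x - x ^+ (N * j).+1) + x ^+ (N * j) * (x - x ^+ N.+1).
  by rewrite mulrBr -exprSr -exprD addnS -mulnSr addrA subrK.
apply: quasinilD IH _; first by comm_solve.
by apply: quasinilMl => //; comm_solve.
Qed.

(* With [e = x ^+ N] and [r = e - e^2], the element [1 - 2 e] squares to
   [1 - 4 r]; dividing it by the square root of the latter gives a square root
   [1 - 2 P] of [1], and [P] is an idempotent close to [e]. *)
Lemma hirano_gpiH N x : (0 < N)%N -> hirano N x -> gpiH_invertible x.
Proof.
case: N => // M _ hx; pose e := x ^+ M.+1.
have cxe : GRing.comm x e by apply: commrX; exact: commr_refl.
have ce w : GRing.comm w x -> GRing.comm w e by move=> c; exact: commrX.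
pose r := e - e * e.
have cr w : GRing.comm w x -> GRing.comm w r.
  by move=> c; apply: commrB (ce _ c) _; apply: commrM; exact: ce.
have qr : quasinil r.
  have -> : r = x ^+ M * (x - x ^+ M.+2) by rewrite mulrBr -exprSr -exprD addnS -addSn exprD.
  apply: quasinilMl hx; apply: commrB; first by apply: commr_sym; apply: commrX; exact: commr_refl.
  by apply: commrX; apply: commr_sym; apply: commrX; exact: commr_refl.
pose r4 := r + r + (r + r).
have r4E : r4 = 4%:R *: r by rewrite scaler_nat /r4 !mulrS mulr0n addr0 !addrA.
have qr4 : quasinil r4 by rewrite r4E; exact: quasinilZ.
have cr4 w : GRing.comm w x -> GRing.comm w r4 by move=> c; rewrite r4E; apply: comm_scale; exact: cr.
have [v [v1 v2]] := quasinil_invertible qr4.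
have cv w : GRing.comm w x -> GRing.comm w v.
  move=> c; apply: commr_sym; apply: comm_inverse v2 v1 _; apply: commr_sym.
  by apply: commrB (commr1 _) _; exact: cr4.
(* [1 + r4 * v = v] inverts [1 - r4], so its square root [1 + y] is an inverse square root of
   [1 - r4]. *)
have qz : quasinil (r4 * v).
  by apply: quasinilM qr4; apply: cv; apply: commr_sym; apply: cr4; exact: commr_refl.
have [y [sq qy cy0]] := quasinil_sqrt qz.
have cy w : GRing.comm w x -> GRing.comm w y.
  by move=> c; apply: cy0; apply: commrM; [exact: cr4 | exact: cv].
have zE : 1 + r4 * v = v.
  by rewrite -{1}v1 mulrBl mul1r subrK.
pose g := 1 - (e + e).
have cg w : GRing.comm w x -> GRing.comm w g.
  by move=> c; apply: commrB (commr1 _) _; apply: commrD; exact: ce.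
pose h := g * (1 + y).
have ch w : GRing.comm w x -> GRing.comm w h.
  by move=> c; apply: commrM (cg _ c) _; apply: commrD (commr1 _) _; exact: cy.
have hh : h * h = 1.
  have c : (1 + y) * g = g * (1 + y).
    apply: commr_sym; apply: commrD (commr1 _) _; apply: cy; apply: commr_sym.
    by apply: cg; exact: commr_refl.
  rewrite /h mulrA -(mulrA g) c mulrA -mulrA sq zE.
  have -> : g * g = 1 - r4 by rewrite /g /r4 /r; ncring.
  by [].
pose P := 2^-1 *: (1 - h).
have cP w : GRing.comm w x -> GRing.comm w P.
  by move=> c; apply: comm_scale; apply: commrB (commr1 _) _; exact: ch.
have cPx : GRing.comm x P by apply: cP; exact: commr_refl.
have PP : P * P = P.
  rewrite /P -scalerAl -scalerAr; congr (_ *: _).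
  have -> : (1 - h) * (1 - h) = 2%:R *: (1 - h).
    by rewrite scaler_nat mulr2n mulrBl !mulrBr hh; ncring.
  by rewrite scalerA mulVf ?pnatr_eq0 // scale1r.
have qPe : quasinil (P - e).
  have -> : P - e = 2^-1 *: (- (g * y)).
    have {1}-> : e = 2^-1 *: (e + e).
      by rewrite -[e + e]mulr2n -[e *+ 2]scaler_nat scalerA mulVf ?pnatr_eq0 // scale1r.
    by rewrite /P -scalerBr; congr (_ *: _); rewrite /h /g; ncring.
  apply: quasinilZ; apply: quasinilN; apply: quasinilMl qy.
  by apply: cy; apply: commr_sym; apply: cg; exact: commr_refl.
have cPe : GRing.comm P e by apply: ce; exact: commr_sym.
have cPPe : GRing.comm P (P - e) by apply: commrB => //; exact: commr_refl.
(* On the corner of [P], [1 - P * (P - e)] acts as [e]; inverting it makes [x] invertible there,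
   with inverse [k]. *)
have [u [u1 u2]] := quasinil_invertible (quasinilMl cPPe qPe).
have cu w : GRing.comm w x -> GRing.comm w u.
  move=> c; apply: commr_sym; apply: comm_inverse u2 u1 _; apply: commr_sym.
  apply: commrB (commr1 _) _; apply: commrM (cP _ c) _.
  by apply: commrB (cP _ c) (ce _ c).
have uP : (1 - P * (P - e)) * P = e * P.
  by rewrite mulrBl mulrBr PP mulrBl -mulrA -cPe !mulrA PP; ncring.
pose k := x ^+ M * (u * P).
have cXM : GRing.comm x (x ^+ M) by apply: commrX; exact: commr_refl.
have ck : GRing.comm x k.
  by apply: commrM cXM _; apply: commrM => //; apply: cu; exact: commr_refl.
have xk : x * k = P.
  by rewrite /k mulrA -exprS -/e mulrA (cu e (commr_sym cxe)) -mulrA -uP mulrA u2 mul1r.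
exists k; split.
- by rewrite -ck xk -(cP k (commr_sym ck)) /k -!mulrA PP.
- by [].
exists M.+1; split=> //; apply/quasinilpotentP.
have -> : x - x ^+ (M.+1 + 2) * k = (x - x ^+ M.+2) + x * ((e - P) * (1 - P)).
  rewrite addn2 exprSr -mulrA xk.
  have -> : (e - P) * (1 - P) = e - e * P.
    by rewrite mulrBl !mulrBr !mulr1 PP subrr subr0.
  by rewrite mulrBr mulrA -exprS addrA subrK.
have cy1 w : GRing.comm w x -> GRing.comm w (x * ((e - P) * (1 - P))).
  move=> c; apply: commrM (c) _; apply: commrM.
    by apply: commrB (ce _ c) (cP _ c).
  by apply: commrB (commr1 _) (cP _ c).
apply: quasinilD hx _.
  apply: cy1; apply: commr_sym; apply: commrB (commr_refl _) _.
  by apply: commrX; exact: commr_refl.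
apply: quasinilMl.
  apply: commrM; first by apply: commrB.
  by apply: commrB (commr1 _) _.
apply: quasinilM.
  by apply: commrB (commr1 _) _; apply: commr_sym; apply: commrB => //; exact: commr_refl.
by rewrite -opprB; exact: quasinilN.
Qed.

(** At the common exponent [K = m * N], up to quasinilpotents [p * u ^+ K] returns to [p] and
    [s ^+ K.+1] to [s], while [p] acts as a unit on [s]. *)
Lemma hirano_mul_root p u s m N : p * p = p -> s * p = s ->
  GRing.comm p u -> GRing.comm p s -> GRing.comm u s -> quasinil (p - u ^+ m) ->
  hirano N s -> hirano (m * N) (u * s).
Proof.
move=> pp sp cpu cps cus qu hs.
have qpu j : quasinil (p - p * u ^+ (m * j)).
  elim: j => [|j IH]; first by rewrite muln0 expr0 mulr1 subrr; exact: quasinil0.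
  have -> : p - p * u ^+ (m * j.+1) = p * (p - u ^+ m) + u ^+ m * (p - p * u ^+ (m * j)).
    have c : u ^+ m * p = p * u ^+ m by apply: (commr_sym (commrX _ cpu)).
    by rewrite mulnS exprD !mulrBr pp !mulrA c addrA subrK.
  apply: quasinilD; first by comm_solve.
    by apply: quasinilMl => //; comm_solve.
  by apply: quasinilMl => //; comm_solve.
rewrite /hirano exprMn_comm //.
set K := (m * N)%N.
have sKp : s ^+ K.+1 * p = s ^+ K.+1 by rewrite exprSr -mulrA sp.
have -> : u * s - u ^+ K.+1 * s ^+ K.+1 =
    u * (s - s ^+ K.+1) + u * (s ^+ K.+1 * (p - p * u ^+ K)).
  have c : GRing.comm (s ^+ K.+1) (u ^+ K) by comm_solve.
  by rewrite !mulrBr !(mulrA (s ^+ K.+1)) sKp c mulrA -exprS addrA subrK.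
have hK : hirano K s by rewrite /K mulnC; exact: hiranoM.
apply: quasinilD; first by comm_solve.
  by apply: quasinilMl => //; comm_solve.
apply: quasinilMl; first by comm_solve.
by apply: quasinilMl; [comm_solve | exact: qpu].
Qed.

(** * Spectral mapping for polynomials *)

Lemma horner_alg_root_invertible x (P : {poly R[i]}) l :
  root P l -> invertible (horner_alg x P) -> invertible (l%:A - x).
Proof.
move=> /factor_theorem[Q ->]; rewrite mulrC rmorphM => h.
have := invertible_comm_factor (rmorph_comm _ _ _) h.
rewrite rmorphB /= horner_algX horner_algC => h1.
rewrite -opprB -scaleN1r;
apply: invertibleZ h1.
by rewrite oppr_eq0 oner_eq0.
Qed.

Lemma horner_alg_invertible x (P : {poly R[i]}) : P != 0 ->
  (forall l, root P l -> invertible (l%:A - x)) -> invertible (horner_alg x P).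
Proof.
move=> P0; have [s Ps] := closed_field_poly_normal P.
have c0 : lead_coef P != 0 by rewrite lead_coef_eq0.
move: (lead_coef P) c0 Ps => c c0 Ps h; rewrite Ps linearZ /= mulr_algl.
apply: invertibleZ => //.
have {}h l : l \in s -> invertible (l%:A - x).
  by move=> ls; apply: h; rewrite Ps rootZ // root_prod_XsubC.
elim: s h {Ps} => [|l s IH] h.
  by rewrite big_nil rmorph1; exists 1; rewrite mulr1.
rewrite big_cons rmorphM /=; apply: invertibleM; last first.
  by apply: IH => k ks; apply: h; rewrite inE ks orbT.
rewrite rmorphB /= horner_algX horner_algC -opprB -scaleN1r.
by apply: invertibleZ; rewrite ?oppr_eq0 ?oner_eq0 //; apply: h; rewrite mem_head.
Qed.

(** The polynomial [1 - l (X - X^(N+1))] has value 1 at 0, so its roots are nonzero and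
    invertibility transfers factor by factor. *)
Lemma hirano_spectrum N x y :
  (forall l, l != 0 -> invertible (l%:A - x) -> invertible (l%:A - y)) ->
  hirano N x -> hirano N y.
Proof.
move=> xy hx; apply: quasinil_of_spectrum => l.
pose P : {poly R[i]} := 1 - l *: ('X - 'X^(N.+1)).
have PE w : horner_alg w P = 1 - l *: (w - w ^+ N.+1).
  by rewrite /P rmorphB rmorph1 -mul_polyC rmorphM rmorphB rmorphXn /=
    horner_algC horner_algX mulr_algl.
have P0 : P.[0] = 1.
  by rewrite /P !hornerE expr0n /= ?(subrr, sub0r, oppr0, mulr0, addr0).
rewrite -PE; apply: horner_alg_invertible.
  by apply/eqP => P00; move: P0; rewrite P00 horner0 => /esym/eqP; rewrite oner_eq0.
move=> k Pk; apply: xy.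
  by apply/eqP => k0; move: Pk; rewrite k0 /root P0 oner_eq0.
apply: horner_alg_root_invertible Pk _; rewrite PE.
by apply: quasinil_invertible; exact: quasinilZ.
Qed.

(** * Perturbation by a quasinilpotent element *)

(** Encodes that all words of length [k] in [a] and [b] kill [x] from the left; the recursion peels
    off the letter adjacent to [x]. *)
Fixpoint annihilated (a b : A) k x : Prop :=
  if k is k'.+1 then annihilated a b k' (a * x) /\ annihilated a b k' (b * x) else x = 0.

Section Annihilated.
Variables a b : A.
Local Notation ann := (annihilated a b).

Lemma annihilatedD k x y : ann k x -> ann k y -> ann k (x + y).
Proof.
elim: k x y => [|k IH] x y /=; first by move=> -> ->; rewrite addr0.
by move=> [x1 x2] [y1 y2]; rewrite !mulrDr; split; apply: IH.
Qed.

Lemma annihilatedMr k x y : ann k x -> ann k (x * y).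
Proof.
elim: k x => [|k IH] x /=; first by move=> ->; rewrite mul0r.
by move=> [x1 x2]; rewrite !mulrA; split; apply: IH.
Qed.

Lemma annihilatedN k x : ann k x -> ann k (- x).
Proof. by rewrite -mulrN1; exact: annihilatedMr. Qed.

Lemma annihilatedZ k l x : ann k x -> ann k (l *: x).
Proof. by rewrite -[x in l *: x]mulr1 scalerAr; exact: annihilatedMr. Qed.

Lemma annihilated0 k : ann k 0.
Proof. by elim: k => [//|k IH] /=; rewrite !mulr0. Qed.

Lemma annihilatedS k x : ann k x -> ann k.+1 x.
Proof.
elim: k x => [|k IH] x; first by move=> ->; exact: annihilated0.
by move=> [/IH h1 /IH h2].
Qed.

Lemma annihilatedMa k x : ann k x -> ann k (a * x).
Proof. by case: k => [/= ->|k [h _]]; [rewrite mulr0 | exact: annihilatedS]. Qed.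

(** Induction through [r x = l^-1 (x + r b x)], where [b x] is killed by words one letter
    shorter. *)
Lemma annihilated_resolvent k l r x : l != 0 -> r * (l%:A - b) = 1 ->
  ann k x -> ann k (r * x).
Proof.
move=> l0 rb; elim: k x => [|k IH] x; first by move=> /= ->; rewrite mulr0.
have -> : r * x = l^-1 *: (x + r * (b * x)).
  have : l *: (r * x) - r * (b * x) = x.
    by rewrite -[RHS]mul1r -rb mulrBr mulrBl -!mulrA mulr_algl -scalerAr.
  by move=> {2}<-; rewrite subrK scalerA mulVf // scale1r.
move=> [h1 h2]; apply: annihilatedZ; apply: annihilatedD; first by split.
by apply: annihilatedS; exact: IH.
Qed.

(** With [r = (l - b)^-1], [l - (a + b) = (1 - a r) (l - b)]. Reordering [(a r)^n] into [a^n r^n]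
    costs an annihilated error, which a prefix [(a r)^k] removes; the powers of [a] then force
    decay. *)
Lemma quasinil_perturbation k l : quasinil a -> ann k (a * b - b * a) -> l != 0 ->
  invertible (l%:A - b) -> invertible (l%:A - (a + b)).
Proof.
move=> qa hc l0 [r [br rb]].
pose c := a * b - b * a.
have hr j x : ann j x -> ann j (r * x) by apply: annihilated_resolvent l0 rb.
have arE : r * a - a * r = - (r * (a * b - b * a) * r).
  transitivity (r * (a * (l%:A - b) - (l%:A - b) * a) * r).
    by rewrite (mulrBr r) (mulrBl r) !mulrA rb mul1r -(mulrA (r * a)) br mulr1.
  have -> : a * (l%:A - b) - (l%:A - b) * a = - (a * b - b * a).
    by rewrite mulrBr mulrBl -(comm_alg l a); ncring.
  by ncring.
have har : ann k (r * a - a * r).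
  by rewrite arE -mulrA; apply: annihilatedN; apply: hr; apply: annihilatedMr.
have har2 n : ann k (r * a ^+ n - a ^+ n * r).
  elim: n => [|n IH]; first by rewrite mulr1 mul1r subrr; exact: annihilated0.
  have -> : r * a ^+ n.+1 - a ^+ n.+1 * r =
      (r * a - a * r) * a ^+ n + a * (r * a ^+ n - a ^+ n * r).
    by rewrite exprS; ncring.
  by apply: annihilatedD; [exact: annihilatedMr | exact: annihilatedMa].
have hpow n : ann k ((a * r) ^+ n - a ^+ n * r ^+ n).
  elim: n => [|n IH]; first by rewrite !expr0 mulr1 subrr; exact: annihilated0.
  have -> : (a * r) ^+ n.+1 - a ^+ n.+1 * r ^+ n.+1 =
     a * (r * ((a * r) ^+ n - a ^+ n * r ^+ n)) + a * ((r * a ^+ n - a ^+ n * r) * r ^+ n).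
    by rewrite !exprS; ncring.
  apply: annihilatedD; first by apply: annihilatedMa; exact: hr.
  by apply: annihilatedMa; exact: annihilatedMr.
(* Each [r] preserves annihilation and each [a] consumes one letter. *)
have kill j x : ann j x -> (a * r) ^+ j * x = 0.
  elim: j x => [|j IH] x; first by move=> /= ->; rewrite mulr0.
  move=> /hr[h _]; rewrite exprSr -!mulrA; exact: IH.
have e n : (a * r) ^+ (k + n) = (a * r) ^+ k * (a ^+ n * r ^+ n).
  by apply: subr0_eq; rewrite exprD -mulrBr; apply: kill; exact: hpow.
have d0 : 0 < 2 * (nrm r + 1) by rewrite mulr_gt0 // ltr_wpDl.
have [C hC] : exists C, forall n, nrm (a ^+ n) <= C * (2 * (nrm r + 1))^-1 ^+ n.
  by apply: qa; rewrite invr_gt0.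
have -> : l%:A - (a + b) = (1 - a * r) * (l%:A - b).
  by rewrite mulrBl mul1r -mulrA rb; ncring.
apply: invertibleM; last by exists r.
apply: (@invertible_of_half_pow _ (nrm ((a * r) ^+ k) * C) k) => n.
rewrite e; apply: le_trans (nM _ _) _; rewrite -!mulrA ler_wpM2l //.
apply: le_trans (nM _ _) _; apply: le_trans (ler_pM (ge0 _) (ge0 _) (hC n) (nrmX _ _)) _.
have C0 : 0 <= C by have := hC 0%N; rewrite !expr0 n1 mulr1; exact: le_trans.
exact: le_half_pow_mul.
Qed.

End Annihilated.

(** * Corners of an idempotent *)

Lemma quasinil_dominated D x y : 0 <= D ->
  (forall n, nrm (y ^+ n.+1) <= D * nrm (x ^+ n.+1)) -> quasinil x -> quasinil y.
Proof.
move=> D0 yx qx e e0; have [C hC] := qx e e0.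
have C0 : 0 <= C by have := hC 0%N; rewrite !expr0 n1 mulr1; exact: le_trans.
have E0 n : 0 <= e ^+ n by rewrite exprn_ge0 ?ltW.
(* The summand 1 covers exponent 0, where the domination hypothesis is silent. *)
exists (1 + D * C) => -[|n].
  by rewrite !expr0 n1 mulr1 lerDl mulr_ge0.
apply: le_trans (yx n) _; rewrite mulrDl -mulrA mul1r.
by apply: ler_wpDl => //; rewrite ler_wpM2l.
Qed.

Lemma invertible_sqr0 x : x * x = 0 -> invertible (1 - x).
Proof. by move=> xx; exists (1 + x); split; rewrite mulrDl !mulrDr !(mulNr, mulrN) xx; ncring. Qed.

Section Corner.
Variables (p : A) (pp : p * p = p).
Let q := 1 - p.

Let pq : p * q = 0.
Proof. by rewrite /q mulrBr pp mulr1 subrr. Qed.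

Section LowerTriangular.
Variables (y : A) (low : p * y * q = 0).

Let pyp : p * y * p = p * y.
Proof.
have /subr0_eq : p * y - p * y * p = 0 by rewrite -low /q mulrBr mulr1.
exact: esym.
Qed.

Let qyq : q * y * q = y * q.
Proof. by rewrite {1}/q mulrBl mul1r mulrBl low subr0. Qed.

(** By triangularity [p * y] and [y * q] are the diagonal blocks, so powers are taken blockwise;
    exponent 0 is excluded because it would give 1 instead of [p]. *)
Lemma corner_upper_exp n : (p * y) ^+ n.+1 = p * y ^+ n.+1.
Proof.
elim: n => [|n IH]; first by rewrite !expr1.
by rewrite exprS IH mulrA pyp -mulrA -exprS.
Qed.

Lemma corner_lower_exp n : (y * q) ^+ n.+1 = y ^+ n.+1 * q.
Proof.
elim: n => [|n IH]; first by rewrite !expr1.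
by rewrite exprSr IH -mulrA (mulrA q) qyq mulrA -exprSr.
Qed.

Lemma low_exp n : p * y ^+ n * q = 0.
Proof.
case: n => [|n]; first by rewrite mulr1.
by rewrite -corner_upper_exp exprSr -mulrA low mulr0.
Qed.

Lemma corner_upper_quasinil : quasinil y -> quasinil (p * y).
Proof.
by apply: (@quasinil_dominated (nrm p)) => // n; rewrite corner_upper_exp.
Qed.

Lemma corner_lower_quasinil : quasinil y -> quasinil (y * q).
Proof.
by apply: (@quasinil_dominated (nrm q)) => // n; rewrite corner_lower_exp mulrC.
Qed.

(** [1 - l y] is a product of three factors, from the upper block, the off-diagonal block, which
    squares to zero, and the lower block. *)
Lemma quasinil_of_corners : quasinil (p * y) -> quasinil (y * q) -> quasinil y.
Proof.
move=> q1 q2; apply: quasinil_of_spectrum => l.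
pose z1 := l *: (p * y); pose z2 := l *: (q * y * p); pose z3 := l *: (y * q).
have z12 : z1 * z2 = 0.
  by rewrite /z1 /z2 -scalerAl -scalerAr -pyp -(mulrA q) -(mulrA _ p) (mulrA p q) pq mul0r mulr0 !scaler0.
have z13 : z1 * z3 = 0.
  by rewrite /z1 /z3 -scalerAl -scalerAr -pyp -qyq -(mulrA q) -(mulrA _ p) (mulrA p q) pq mul0r mulr0 !scaler0.
have z23 : z2 * z3 = 0.
  by rewrite /z2 /z3 -scalerAl -scalerAr -qyq -(mulrA q y q) -(mulrA _ p) (mulrA p q) pq mul0r mulr0 !scaler0.
have z22 : z2 * z2 = 0.
  by rewrite /z2 -scalerAl -scalerAr -{2}(mulrA q) -(mulrA _ p) (mulrA p q) pq mul0r mulr0 !scaler0.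
have -> : 1 - l *: y = (1 - z1) * (1 - z2) * (1 - z3).
  have -> : (1 - z1) * (1 - z2) = 1 - z1 - z2 by rewrite mulrBl !mulrBr z12; ncring.
  have -> : (1 - z1 - z2) * (1 - z3) = 1 - (z1 + z2 + z3).
    by rewrite !mulrBl !mulrBr z13 z23; ncring.
  rewrite /z1 /z2 /z3 -!scalerDr; congr (1 - l *: _).
  have -> : q * y * p = y * p - p * y by rewrite /q !mulrBl pyp mul1r.
  by rewrite /q; ncring.
apply: invertibleM; first apply: invertibleM.
- by apply: quasinil_invertible; exact: quasinilZ.
- exact: invertible_sqr0.
- by apply: quasinil_invertible; exact: quasinilZ.
Qed.

End LowerTriangular.

Lemma low_hirano y N : p * y * q = 0 -> p * (y - y ^+ N.+1) * q = 0.
Proof. by move=> low; rewrite (mulrBr p) (mulrBl q) low low_exp // subrr. Qed.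

Lemma corner_upper_hirano y N : p * y * q = 0 -> hirano N y -> hirano N (p * y).
Proof.
move=> low; rewrite /hirano corner_upper_exp // -mulrBr.
by apply: corner_upper_quasinil; exact: low_hirano.
Qed.

Lemma corner_lower_hirano y N : p * y * q = 0 -> hirano N y -> hirano N (y * q).
Proof.
move=> low; rewrite /hirano corner_lower_exp // -mulrBl.
by apply: corner_lower_quasinil; exact: low_hirano.
Qed.

Lemma hirano_of_corners y N : p * y * q = 0 ->
  hirano N (p * y) -> hirano N (y * q) -> hirano N y.
Proof.
move=> low; rewrite /hirano corner_upper_exp // corner_lower_exp // -mulrBr -mulrBl.
by apply: quasinil_of_corners; exact: low_hirano.
Qed.

(** [p * x = 0] means [x = q x], and triangularity keeps [a x] and [b x] in that corner, so the
    letters may be compressed by [q]. *)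
Lemma annihilated_corner a b k x : p * a * q = 0 -> p * b * q = 0 -> p * x = 0 ->
  annihilated a b k x -> annihilated (a * q) (b * q) k x.
Proof.
move=> la lb; elim: k x => [//|k IH] x px /= [h1 h2].
have qx : q * x = x by rewrite /q mulrBl mul1r px subr0.
rewrite -!mulrA qx; split; apply: IH => //.
  by rewrite -qx !mulrA la mul0r.
by rewrite -qx !mulrA lb mul0r.
Qed.

(** The perturbation result inside the corner of [q], where the compressed elements have commutator
    [(a b - b a) q]. *)
Lemma hirano_lower_sum a b k N : p * a * q = 0 -> p * b * q = 0 ->
  quasinil (a * q) -> hirano N (b * q) -> annihilated a b k (a * b - b * a) ->
  hirano N (a * q + b * q).
Proof.
move=> la lb qa hb hc; apply: hirano_spectrum hb => l l0.
apply: (@quasinil_perturbation _ _ k) => //.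
have lower u v : p * u * q = 0 -> p * (u * q * (v * q)) = 0.
  by move=> lu; rewrite !mulrA lu !mul0r.
have qyq y : p * y * q = 0 -> q * (y * q) = y * q.
  by move=> ly; rewrite {1}/q mulrBl mul1r mulrA ly subr0.
have eab : a * q * (b * q) = a * b * q by rewrite -mulrA qyq // mulrA.
have eba : b * q * (a * q) = b * a * q by rewrite -mulrA qyq // mulrA.
apply: annihilated_corner => //.
  by rewrite mulrBr !lower // subrr.
by rewrite eab eba -mulrBl; exact: annihilatedMr.
Qed.

End Corner.

(** * From the word hypothesis and the inverse of [a] to the equivalence *)

Lemma annihilated_of_words a b k x :
  (forall alpha : 'I_k -> A, (forall j, alpha j = a \/ alpha j = b) ->
     (\prod_(j < k) alpha j) * x = 0) -> annihilated a b k x.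
Proof.
elim: k x => [|k IH] x h.
  have := h (fun=> a) (fun=> or_introl erefl).
  by rewrite big_ord0 mul1r.
suff H y : y = a \/ y = b -> annihilated a b k (y * x).
  by split; apply: H; [left | right].
move=> hy; apply: IH => alpha halpha.
(* [insub] fails exactly at the last index [k], where the default [y] becomes the letter next to
   [x]. *)
pose alpha' (i : 'I_k.+1) := oapp alpha y (insub (i : nat)).
have := h alpha'; rewrite big_ord_recr /= -mulrA => <-.
  congr (_ * (_ * _)); last by rewrite /alpha' /= insubF // ltnn.
  by apply: eq_bigr => i _; rewrite /alpha' /= valK.
by move=> i; rewrite /alpha'; case: insub => [j|] /=; [exact: halpha | exact: hy].
Qed.

(** Multiplying the quasinilpotent [a - a^(n+2) g] by [1 - a g] and by [g] gives the first two
    quasinilpotents; the other two follow from these and the original one. *)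
Lemma gpiH_inverse_quasinil a g : gpiH_inverse a g -> exists n,
  [/\ (0 < n)%N, quasinil (a * (1 - a * g)), quasinil (a * g - a ^+ n * (a * g)),
      quasinil (a * g - g ^+ n) & hirano n a].
Proof.
move=> [gag cag [n [n0 /quasinilpotentP qa]]].
have c : GRing.comm a g by [].
pose p := a * g; have pg : p * g = g by rewrite /p cag.
have gp : g * p = g by rewrite /p mulrA.
have pp : p * p = p by rewrite /p -mulrA (mulrA g) gag.
have cpa : GRing.comm p a by rewrite /p; comm_solve.
have cpg : GRing.comm p g by rewrite /p; comm_solve.
have gq : g * (1 - p) = 0 by rewrite mulrBr gp mulr1 subrr.
have aX : a ^+ (n + 2) * g = a ^+ n.+1 * p by rewrite addn2 exprSr -mulrA.
have q1 : quasinil (a * (1 - p)).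
  have -> : a * (1 - p) = (a - a ^+ (n + 2) * g) * (1 - p).
    by rewrite mulrBl -(mulrA _ g) gq mulr0 subr0.
  by apply: quasinilM => //; comm_solve.
have q2 : quasinil (p - a ^+ n * p).
  have -> : p - a ^+ n * p = (a - a ^+ (n + 2) * g) * g.
    rewrite mulrBl aX -mulrA pg exprSr -mulrA -/p //.
  by apply: quasinilM => //; comm_solve.
exists n; split=> //.
  have -> : p - g ^+ n = - (g ^+ n * (p - a ^+ n * p)).
    have gnp : g ^+ n * p = g ^+ n.
      by case: n n0 {qa aX q2} => // n _; rewrite exprSr -mulrA gp.
    have ga : g ^+ n * a ^+ n = p.
      case: n n0 {qa aX q2 gnp} => // n _.
      rewrite -exprMn_comm; last exact: commr_sym.
      rewrite -cag -/p.
      by elim: n => [|n IH]; rewrite ?expr1 // exprS IH pp.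
    by rewrite mulrBr gnp mulrA ga pp opprB.
  by apply: quasinilN; apply: quasinilMl => //; comm_solve.
rewrite /hirano.
have -> : a - a ^+ n.+1 = (a - a ^+ (n + 2) * g) - a ^+ n * (a * (1 - p)).
  by rewrite aX mulrA -exprSr mulrBr mulr1 opprB addrA subrK.
apply: quasinilB => //; first by comm_solve.
by apply: quasinilMl => //; comm_solve.
Qed.

Lemma gpiH_hirano x : gpiH_invertible x <-> exists N, (0 < N)%N /\ hirano N x.
Proof.
split=> [[g /gpiH_inverse_quasinil [n [n0 _ _ _ h]]]|[N [N0 h]]].
  by exists n.
exact: hirano_gpiH h.
Qed.

Lemma annihilated_exp a b k x : annihilated a b k x -> a ^+ k * x = 0.
Proof.
elim: k x => [|k IH] x /=; first by move=> ->; rewrite mulr0.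
by case=> h _; rewrite exprSr -mulrA; exact: IH.
Qed.

(* With [p = a g] and [q = 1 - p], the elements [a], [g] and [p b] commute and
   [p b q = 0], so that [w = 1 + g b] and [d = a + b] are triangular for [p], [q]:
   [w] has diagonal blocks [v] and [q], [d] has blocks [s] and [a q + b q], where
   [v = g s] and [s = a p v]. *)
Lemma gpiH_iff_sum k a b g : gpiH_invertible b ->
  annihilated a b k (a * b - b * a) ->
  gpiH_inverse a g -> (gpiH_invertible (1 + g * b) <-> gpiH_invertible (a + b)).
Proof.
move=> /gpiH_hirano[M [M0 hb]] hann hg; have hc := annihilated_exp hann.
have [gag cag _] := hg.
have [n [n0 qaq qan qgn _]] := gpiH_inverse_quasinil hg.
have c : GRing.comm a g by [].
move: qaq qan qgn; set p := a * g => qaq qan qgn.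
have pg : p * g = g by rewrite /p cag.
have gp : g * p = g by rewrite /p mulrA.
have pp : p * p = p by rewrite /p -mulrA (mulrA g) gag.
have cpa : GRing.comm p a by rewrite /p; comm_solve.
have cpg : GRing.comm p g by rewrite /p; comm_solve.
have gX j : g ^+ j.+1 * a ^+ j = g.
  elim: j => [|j IH]; first by rewrite expr1 mulr1.
  by rewrite exprS [a ^+ _]exprSr mulrA -(mulrA g) IH -mulrA -cag.
(* [g = g^(k+1) a^k] puts the annihilating word [a^k] in front of the commutator. *)
have gc : g * a * b = g * b * a.
  by apply: subr0_eq; rewrite -!mulrA -mulrBr -{1}(gX k) -mulrA hc mulr0.
pose d := p * b.
have pbE : d = g * b * a by rewrite /d /p cag gc.
have cda : GRing.comm d a.
  by rewrite /GRing.comm {1}/d {1}/p -!mulrA (mulrA g) -pbE.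
have pd : p * d = d by rewrite /d mulrA pp.
set q := 1 - p in qaq.
have qa : q * a = a * q by rewrite /q; apply: commr_sym; comm_solve.
have qq : q * q = q by rewrite /q mulrBl !mulrBr pp; ncring.
have gd : g * d = g * b by rewrite /d mulrA gp.
(* [d q] is fixed by [w -> g w (a q)]; as [a q] is quasinilpotent, iterating forces [d q = 0]. *)
have dqX j : d * q = g ^+ j * (d * q) * (a * q) ^+ j.
  elim: j => [|j IH]; first by rewrite mul1r mulr1.
  have e : g * (d * q) * (a * q) = d * q.
    have -> : g * (d * q) * (a * q) = g * d * (q * a) * q by rewrite !mulrA.
    have -> : g * d * (q * a) * q = g * (d * a) * (q * q) by rewrite qa !mulrA.
    by rewrite qq cda mulrA -cag -/p pd.
  rewrite exprSr [(a * q) ^+ j.+1]exprS.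
  have -> : g ^+ j * g * (d * q) * (a * q * (a * q) ^+ j) =
      g ^+ j * (g * (d * q) * (a * q)) * (a * q) ^+ j by rewrite !mulrA.
  by rewrite e.
have dq : d * q = 0.
  have d0 : 0 < 2 * (nrm g + 1) by rewrite mulr_gt0 // ltr_wpDl.
  have [C hC] : exists C, forall j, nrm ((a * q) ^+ j) <= C * (2 * (nrm g + 1))^-1 ^+ j.
    by apply: qaq; rewrite invr_gt0.
  have C0 : 0 <= C by have := hC 0%N; rewrite !expr0 n1 mulr1; exact: le_trans.
  apply: (@le_half_pow_eq0 _ (nrm (d * q) * C)) => j.
  rewrite {1}(dqX j); apply: le_trans (nM _ _) _.
  apply: (@le_trans _ _ (nrm (d * q) * (C * (2 * (nrm g + 1))^-1 ^+ j * nrm g ^+ j))).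
    rewrite [X in _ <= _ * X]mulrC [leRHS]mulrA; apply: ler_pM => //.
    apply: le_trans (nM _ _) _; rewrite mulrC; apply: ler_wpM2l => //; exact: nrmX.
  by rewrite -(mulrA (nrm (d * q))) ler_wpM2l //; exact: le_half_pow_mul.
have dp : d * p = d.
  have /subr0_eq : d - d * p = 0 by rewrite -dq /q mulrBr mulr1.
  exact: esym.
have cdp : GRing.comm d p by rewrite /GRing.comm dp pd.
have cdg : GRing.comm d g.
  transitivity (g * (a * d) * g); first by rewrite -{1}pd /p cag !mulrA.
  have -> : g * (a * d) * g = g * (d * p) by rewrite -cda /p !mulrA.
  by rewrite dp.
have lowa : p * a * q = 0.
  by rewrite cpa -mulrA /q mulrBr pp mulr1 subrr mulr0.
have lowb : p * b * q = 0 by [].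
have low : p * (a + b) * q = 0 by rewrite (mulrDr p) (mulrDl _ _ q) lowa lowb addr0.
pose s := p * a + d; pose v := p + g * d.
have sE : p * (a + b) = s by rewrite mulrDr.
have vE : p * (1 + g * b) = v by rewrite mulrDr mulr1 mulrA pg -gd.
have loww : p * (1 + g * b) * q = 0.
  by rewrite vE /v (mulrDl _ _ q) -(mulrA g) dq mulr0 addr0 /q mulrBr pp mulr1 subrr.
have sp : s * p = s by rewrite /s mulrDl dp -mulrA -cpa mulrA pp.
have vp : v * p = v by rewrite /v mulrDl pp -mulrA dp.
have gs : g * s = v by rewrite /s mulrDr mulrA gp -cag.
have av : a * p * v = s.
  by rewrite /v mulrDr -mulrA pp -cpa -(mulrA p) (mulrA a) -/p mulrA pp pd.
split=> /gpiH_hirano[N [N0 hN]]; apply/gpiH_hirano.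
  (* [s = (a p) v], and [(a p)^n = a^n p] equals [p] up to a quasinilpotent. *)
  have hs : hirano (n * N) s.
    rewrite -av; apply: (@hirano_mul_root p) => //; try by rewrite /v; comm_solve.
      rewrite exprMn_comm; last exact: commr_sym.
      have -> : p ^+ n = p by case: n n0 {qan qgn} => // n _; elim: n => // n IH; rewrite exprS IH pp.
      exact: qan.
    by rewrite -vE; exact: corner_upper_hirano.
  (* [n * N] serves the upper block and [M] the lower one. *)
  exists (n * N * M)%N; split; first by rewrite !muln_gt0 n0 N0 M0.
  apply: (hirano_of_corners pp low); first by rewrite sE; exact: hiranoM.
  rewrite mulrDl mulnC; apply: hiranoM.
  by apply: hirano_lower_sum hann => //; exact: corner_lower_hirano.
exists (n * N)%N; split; first by rewrite muln_gt0 n0 N0.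
apply: (hirano_of_corners pp loww).
  (* Conversely [v = g s], and [g^n] equals [p] up to a quasinilpotent. *)
  rewrite vE -gs; apply: (@hirano_mul_root p) => //; try by rewrite /s; comm_solve.
  by rewrite -sE; exact: corner_upper_hirano.
(* The lower block is the idempotent [q], for which any exponent works. *)
have -> : (1 + g * b) * q = q by rewrite (mulrDl _ _ q) mul1r -gd -(mulrA g) dq mulr0 addr0.
rewrite /hirano; have -> : q ^+ (n * N).+1 = q.
  by elim: (n * N)%N => // j IH; rewrite exprS IH qq.
by rewrite subrr; exact: quasinil0.
Qed.

End BanachAlgebra.

Unset Implicit Arguments.
Set Strict Implicit.

Theorem theorem3p10 (R : realType) (A : algType R[i]) (nrm : A -> R)
  (HA : banach_algebra_norm nrm) (k : nat) (a b : A) :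
  (0 < k)%N ->
  gpiH_invertible a -> gpiH_invertible b ->
  (forall alpha : 'I_k -> A, (forall j, alpha j = a \/ alpha j = b) ->
     (\prod_(j < k) alpha j) * a * b = (\prod_(j < k) alpha j) * b * a) ->
  forall aH : A, gpiH_inverse a aH ->
  (gpiH_invertible (1 + aH * b) <-> gpiH_invertible (a + b)).
Proof.
move=> _ _ hb hab aH; apply: (gpiH_iff_sum HA (k := k) hb).
apply: annihilated_of_words => alpha /hab.
by rewrite mulrBr !mulrA => ->; rewrite subrr.
Qed.
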